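(* Let $d\ge 2$. For every $(m,l,s)$-pedigree $G$, let \[ \mathfrak a:=l-(ds+1) \] (the excess in leaves) and let $\mathfrak b$ be the tree excess \[ \mathfrak b:=|E(G)|-(|V(G)|-1)=dm-(l-1). \] Then $\mathfrak a\ge 0$ and \[ \mathfrak b\le d\,\mathfrak a^{(d+1)/d}+(d^2-1)\,\mathfrak a . \]
   Context: $[n]=\{1,\ldots,n\}$ and $\binom{[n]}{d+1}$ is the family of $(d+1)$-element subsets of $[n]$; $n$ is an arbitrary positive integer here. Pedigrees. Let $G$ be a (finite) directed acyclic graph on a vertex set $V\subseteq\binom{[n]}{d+1}$. $G$ is an $(m,l,s)$-pedigree for a vertex $\mathbf o\in V$ if: (1) [root] $\mathbf o$ is the unique vertex of $G$ with in-degree $0$; (2) [out-degrees] $G$ has $m+l$ vertices, of which $m$ have out-degree $d+1$ (internal vertices) and the remaining $l$ have out-degree $0$ (leaves); (3) [labels] $\big|\bigcup_{\mathbf u\in V}\mathbf u\big|=s+d+1$; (4) [stacking] if a vertex $\mathbf u=\{x_1<x_2<\cdots<x_{d+1}\}$ has outgoing edges to $\mathbf v_1,\ldots,\mathbf v_{d+1}$, then there is some $z\notin\mathbf u$ such that $\mathbf v_i=(\mathbf u\setminus\{x_i\})\cup\{z\}$ for all $i$ (the label $z$ is called the outgoing label of $\mathbf u$). $V(G)$ and $E(G)$ denote the vertex and edge sets of $G$. *)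

(* Defs.v *)
From HB Require Import structures.
From mathcomp Require Import all_boot all_order all_algebra.
Set Implicit Arguments.
Unset Strict Implicit.
Unset Printing Implicit Defensive.
Import Order.TTheory GRing.Theory Num.Theory.

Record digraph (T : finType) := Digraph {
  vertices : {set T};
  edges : {set T * T};
  edges_sub : edges \subset setX vertices vertices }.

Section Digraph.
Variables (T : finType) (G : digraph T).

Definition arc : rel T := fun u v => (u, v) \in edges G.

Definition out_nbrs (u : T) : {set T} := [set v | arc u v].

Definition in_nbrs (v : T) : {set T} := [set u | arc u v].

Definition outdeg (u : T) : nat := #|out_nbrs u|.

Definition indeg (v : T) : nat := #|in_nbrs v|.

(* Loops are the sequences [:: u] and antiparallel arcs the sequences
   [:: u; v], so both are excluded. *)
Definition acyclic : Prop := forall c : seq T, ucycle arc c -> c = [::].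

Definition tree_excess : int := (#|edges G|%:Z - (#|vertices G|%:Z - 1))%R.

End Digraph.

(* The label set {1, ..., n} is represented by 'I_n.  In [ped_stacking], the set
   equality amounts to v_i = (u minus x_i) plus z for a suitable numbering
   of the out-neighbours, since these d + 1 sets are pairwise distinct. *)
Record pedigree (n d m l s : nat) (G : digraph {set 'I_n})
    (o : {set 'I_n}) : Prop := Pedigree {
  ped_card : forall u, u \in vertices G -> #|u| = d.+1;
  ped_acyclic : acyclic G;
  ped_root_in : o \in vertices G;
  ped_root : forall u, u \in vertices G -> (indeg G u = 0 <-> u = o);
  ped_order : #|vertices G| = m + l;
  ped_internal : #|[set u in vertices G | outdeg G u == d.+1]| = m;
  ped_leaves : #|[set u in vertices G | outdeg G u == 0]| = l;
  ped_labels : #|\bigcup_(u in vertices G) u| = s + d + 1;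
  ped_stacking : forall u, u \in vertices G -> outdeg G u = d.+1 ->
    exists2 z : 'I_n, z \notin u &
      out_nbrs G u = [set z |: (u :\ x) | x in u] }.

Definition leaf_excess (d l s : nat) : int := (l%:Z - (d%:Z * s%:Z + 1))%R.

(* Main.v *)
Require Import Defs.
From HB Require Import structures.
From mathcomp Require Import all_boot all_order all_algebra.
From mathcomp Require Import reals exp.
From mathcomp Require Import finfield boolp zify lra.
Set Implicit Arguments.
Unset Strict Implicit.
Unset Printing Implicit Defensive.
Import Order.TTheory GRing.Theory Num.Theory.
Local Open Scope ring_scope.

Local Notation arc := Defs.arc.

(** Write [a] for the excess in leaves and e for the excess m - s of internal
    vertices over labels outside the root.  Since every internal vertex has
    d + 1 children, the tree excess is d * e - a, and the claim becomes
    e <= a ^ ((d + 1) / d) + d * a.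

    The proof is a linear version of the Kruskal-Katona theorem.  Place the
    labels in general position in d-space, and give each label outside the root
    one additional coordinate of its own.  A vertex of the pedigree becomes a
    d-simplex in dimension d + s, and its vector of d-dimensional volumes in
    all coordinate d-subspaces is [vol u].  Two facts about boundaries drive
    everything.
    - The volume vectors of the facets of a (d + 1)-simplex satisfy a linear
      relation ([sum_vol_facets]).  So the vector of an internal vertex is a
      combination of those of its children, and all of them lie in the span of
      the l vectors of the leaves ([vol_leaf_span]).
    - An internal vertex u together with its outgoing label z is a
      (d + 1)-simplex, the [cell] of u.  A vertex is a facet only of its own
      cell and of those of its parents.  Since the digraph is acyclic, the m
      vectors of (d + 1)-volumes of the cells are therefore linearly
      independent ([cell_independent]).

    Order the sets of coordinates by a weight compatible with inserting a
    coordinate.  The leading sets of a space of vectors are as many as its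
    dimension ([card_lead]), so there are m leading (d + 1)-sets for the cells
    and at most l leading d-sets for the leaves.  Expanding a determinant along
    a column shows that removing an element from a leading set of the cells
    gives a leading set of the leaves ([lead_shadow]).

    Let the d axes of the general position picture weigh most.  Following the
    pedigree down from the root, each new label z contributes d independent
    directions, since its cell has a nondegenerate base; so all d * s + 1
    d-sets with at least d - 1 axes are leading for the leaves
    ([near_axes_sub_lead]).  Hence [a] is nonnegative and bounds the number of
    the other leading d-sets, which have at most d - 2 axes.  Among the m
    leading (d + 1)-sets, at most s contain all axes.  Those with d - 1 axes are
    at most d * a, because deleting an axis yields one of these other d-sets.
    Those with at most d - 2 axes have their whole shadow among these d-sets, so
    they number at most a ^ ((d + 1) / d) ([shadow_bound]).

    Over a field of characteristic 2 the determinants are permanents, so volumes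
    are functions of unordered sets and no orientation has to be tracked. *)

(** * Permanents in characteristic 2 *)

Section Permanent.
Variables (F : fieldType) (n : nat).
Implicit Types (u : {set 'I_n}) (g h : {ffun 'I_n -> F}).
Implicit Type gs : seq {ffun 'I_n -> F}.

(** The permanent of the matrix with rows [u] and columns [gs], expanded along
    its first column.  Without signs it is a function of the set of rows. *)
Fixpoint permanent u gs : F :=
  if gs is g :: gs' then \sum_(i in u) g i * permanent (u :\ i) gs'
  else (u == set0)%:R.

Lemma permanent_neq0_card u gs : permanent u gs != 0 -> #|u| = size gs.
Proof.
elim: gs u => [|g gs IH] u /=.
  by case: (eqVneq u set0) => [->|]; rewrite ?cards0 ?eqxx.
have [i /andP[iu /IH sz] _|no] :=
    pickP [pred i in u | permanent (u :\ i) gs != 0].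
  by rewrite (cardsD1 i) iu sz.
rewrite big1 ?eqxx // => i iu; move/negbT: (no i).
by rewrite /= iu /= negbK => /eqP ->; rewrite mulr0.
Qed.

Lemma permanent_swap u g h gs :
  permanent u (g :: h :: gs) = permanent u (h :: g :: gs).
Proof.
rewrite /=; under eq_bigr do rewrite big_distrr /=.
under [RHS]eq_bigr do rewrite big_distrr /=.
rewrite (exchange_big_dep (mem u)) /= => [|i j _ /setD1P[]//].
apply: eq_bigr => i iu; apply: eq_big => [j|j _].
  by rewrite !inE iu andbT andbC eq_sym.
by rewrite mulrCA setDDl setDDl setUC.
Qed.

Lemma permanent_ext u g gs hs : (forall v, permanent v gs = permanent v hs) ->
  permanent u (g :: gs) = permanent u (g :: hs).
Proof. by move=> e /=; apply: eq_bigr => i _; rewrite e. Qed.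

Lemma permanent_insert u g gs hs :
  permanent u (gs ++ g :: hs) = permanent u (g :: gs ++ hs).
Proof.
elim: gs u => //= h gs IH u.
rewrite -[RHS]/(permanent u (g :: h :: gs ++ hs)) permanent_swap.
exact: permanent_ext.
Qed.

Lemma permanent_perm u gs hs : perm_eq gs hs -> permanent u gs = permanent u hs.
Proof.
elim: gs hs u => [|g gs IH] hs u; first by rewrite perm_sym => /perm_nilP ->.
move=> e; have gh : g \in hs by rewrite -(perm_mem e) mem_head.
move: e; case/path.splitPr: gh => h1 h2 e; rewrite permanent_insert.
apply: permanent_ext => v; apply: IH.
by rewrite -(perm_cons g) (perm_trans e) // perm_catC /= perm_cons perm_catC.
Qed.

Lemma permanent_indicator u x g gs :
  x \in u -> {in u, forall y, g y = (x == y)%:R} ->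
  permanent u (g :: gs) = permanent (u :\ x) gs.
Proof.
move=> xu e; rewrite /= (bigD1 x) //= e // eqxx mul1r big1 ?addr0 // =>
  i /andP[iu ix].
by rewrite e // eq_sym (negbTE ix) mul0r.
Qed.

Lemma permanent_zero u g gs :
  {in u, forall y, g y = 0} -> permanent u (g :: gs) = 0.
Proof. by move=> e /=; rewrite big1 // => i iu; rewrite e // mul0r. Qed.

Lemma permanent_front u g gs :
  g \in gs -> permanent u gs = permanent u (g :: rem g gs).
Proof. by move=> gg; apply/permanent_perm/perm_to_rem. Qed.

Lemma permanent_vanish u g gs :
  g \in gs -> {in u, forall y, g y = 0} -> permanent u gs = 0.
Proof. by move=> gg g0; rewrite (permanent_front u gg) permanent_zero. Qed.

Definition dirac (x : 'I_n) : {ffun 'I_n -> F} := [ffun y => (x == y)%:R].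

Lemma permanent_diracs z (xs : seq 'I_n) : uniq (z :: xs) ->
  permanent (z |: [set x in xs]) ([ffun=> 1] :: map dirac xs) = 1.
Proof.
rewrite -[map dirac xs]cats0 -permanent_insert.
elim: xs => [|x xs IH] /=.
  move=> _; rewrite set_nil setU0 big_set1 setDv eqxx ffunE !mulr1 //.
rewrite inE negb_or => /andP[/andP[zx zxs] /andP[xxs uxs]].
rewrite -[LHS]/(permanent (z |: [set x' in x :: xs])
  (dirac x :: map dirac xs ++ [:: [ffun=> 1]])).
rewrite (permanent_indicator (x := x)); first last.
- by move=> y _; rewrite ffunE.
- by rewrite !inE eqxx orbT.
rewrite (_ : _ :\ _ = z |: [set x' in xs]) ?IH //= ?zxs //.
apply/setP=> y; rewrite !inE; case: (eqVneq y x) => //= ->.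
by rewrite eq_sym (negbTE zx) (negbTE xxs).
Qed.

Hypothesis char2 : 2 \in [pchar F].

(** In characteristic 2 the terms that choose rows i, j and rows j, i for the
    two equal columns cancel. *)
Lemma permanent_dup u g gs : permanent u (g :: g :: gs) = 0.
Proof.
rewrite /=; under eq_bigr do rewrite big_distrr /=.
rewrite pair_big_dep /=.
rewrite (bigID (fun p : 'I_n * 'I_n => (p.1 < p.2)%N)) /=.
pose sw (p : 'I_n * 'I_n) := (p.2, p.1).
have swK : involutive sw by case.
rewrite [X in _ + X](reindex_inj (can_inj swK)) /=.
rewrite -[RHS](addrr_pchar2 char2
  (\sum_(p | (p.1 \in u) && (p.2 \in u :\ p.1) && (p.1 < p.2)%N)
    g p.1 * (g p.2 * permanent (u :\ p.1 :\ p.2) gs))).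
congr (_ + _); apply: eq_big => [[i j]|[i j] _] /=.
  rewrite !inE -(val_eqE i j) -(val_eqE j i) /=.
  by case: ltngtP; rewrite ?andbF ?andbT //= ?andbT andbC.
by rewrite mulrCA setDDl setDDl setUC.
Qed.

Lemma permanent_dup_in u g gs : g \in gs -> permanent u (g :: gs) = 0.
Proof.
case/path.splitPr=> h1 h2.
by rewrite (permanent_ext _ _ (fun v => permanent_insert v g h1 h2))
  permanent_dup.
Qed.

Lemma permanent_not_uniq u gs : ~~ uniq gs -> permanent u gs = 0.
Proof.
elim: gs u => //= g gs IH u; rewrite negb_and negbK => /orP[|nu].
  exact: permanent_dup_in.
by rewrite big1 // => i _; rewrite IH ?mulr0.
Qed.

(** Laplace expansion, where all cofactor signs are 1. *)
Lemma permanent_det k (r : 'I_k -> 'I_n) (c : 'I_k -> {ffun 'I_n -> F}) :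
  injective r ->
  permanent [set r i | i in 'I_k] [seq c j | j <- enum 'I_k] =
  \det (\matrix_(i, j) c j (r i)).
Proof.
elim: k r c => [|k IH] r c r_inj.
  rewrite det_mx00 enum_ord0 /=; case: eqP => // /eqP/set0Pn[x /imsetP[[]]//].
rewrite enum_ordSl /= -map_comp (expand_det_col _ ord0) big_imset /=;
  last by move=> ? ? _ _; apply: r_inj.
apply: eq_bigr => i _; rewrite mxE; congr (_ * _).
rewrite /cofactor -signr_odd.
rewrite (_ : (-1) ^+ _ = 1 :> F) ?mul1r; last first.
  by case: (odd _); rewrite ?expr0 ?expr1 ?(oppr_pchar2 char2).
have -> : [set r i | i in 'I_k.+1] :\ r i = [set (r \o lift i) j | j in 'I_k].
  apply/setP=> x; rewrite !inE;
    apply/andP/imsetP => [[xi /imsetP[j _ e]]|[j _ ->]].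
    move: xi; rewrite e (inj_eq r_inj) eq_sym => /unlift_some[j' -> _];
      by exists j'.
  by rewrite /= (inj_eq r_inj) eq_sym neq_lift imset_f.
rewrite IH; last by move=> x y /r_inj/lift_inj.
congr (\det _); by apply/matrixP=> a b; rewrite !mxE.
Qed.

Lemma permanent_vandermonde (t : 'I_n -> F) u d : injective t -> #|u| = d ->
  permanent u [seq [ffun x => t x ^+ (val j)] | j <- enum 'I_d] != 0.
Proof.
move=> t_inj <-.
have -> : u = [set enum_val i | i in 'I_#|u|] :> {set 'I_n}.
  apply/setP=> x; apply/idP/imsetP => [xu|[i _ ->]]; last exact: enum_valP.
  by exists (enum_rank_in xu x); rewrite ?enum_rankK_in.
rewrite card_imset; last exact: enum_val_inj.
rewrite cardT size_enum_ord.
rewrite (permanent_det (fun j : 'I_#|u| => [ffun x => t x ^+ val j]));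
  last exact: enum_val_inj.
rewrite -det_tr.
have -> : (\matrix_(i, j) [ffun x => t x ^+ (val j)] (enum_val i))^T =
   @Vandermonde F #|u| #|u| (\row_i t (enum_val i)).
  by apply/matrixP=> i j; rewrite !mxE ffunE.
rewrite det_Vandermonde; apply/prodf_neq0 => i _; apply/prodf_neq0 => j ij.
by rewrite !mxE subr_eq0 (inj_eq t_inj) (inj_eq enum_val_inj) -(inj_eq val_inj)
  gtn_eqF.
Qed.
End Permanent.

(** * Leading indices of a space of vectors *)

Section LeadingSet.
Variables (F : fieldType) (I : finType) (k : I -> nat).
Implicit Types (v : {ffun I -> F^o}) (A : {vspace {ffun I -> F^o}}).

Definition leads v i := v i != 0 /\ forall j, (k i < k j)%N -> v j = 0.

Definition lead A : {set I} := [set i | `[< exists2 v, v \in A & leads v i >]].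

Lemma leadP A i : reflect (exists2 v, v \in A & leads v i) (i \in lead A).
Proof. by rewrite inE; apply: asboolP. Qed.

Hypothesis k_inj : injective k.

(** Vectors with distinct leading indices are independent, as in a triangular
    system; conversely a nonzero vector of [A] has its own leading index among
    those of [A], so restricting coordinates to [lead A] is injective on [A]. *)
Lemma card_lead A : #|lead A| = \dim A.
Proof.
apply/eqP; rewrite eqn_leq; apply/andP; split.
- have /choice[w wP] : forall j : 'I_#|lead A|, exists v,
      v \in A /\ leads v (enum_val j).
    by move=> j; have /leadP[v vA vl] := enum_valP j; exists v.
  have fr : free (mktuple w).
    apply/freeP=> c c0 j.
    apply/eqP/negPn/negP => cj.
    have [m cm mmax] :=
      @arg_maxnP _ j (fun j => c j != 0) (fun j => k (enum_val j)) cj.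
    have := congr1 (fun f : {ffun I -> F^o} => f (enum_val m)) c0.
    rewrite sum_ffunE ffunE (bigD1 m) //= big1 ?addr0 => [|i im].
      rewrite ffunE nth_mktuple => /eqP.
      by rewrite mulf_eq0 (negbTE cm) (negbTE (wP m).2.1).
    rewrite ffunE nth_mktuple; have [->|ci] := eqVneq (c i) 0;
      first exact: mul0r.
    rewrite (wP i).2.2 ?scaler0 // ltn_neqAle; apply/andP; split;
      last exact: mmax.
    by rewrite (inj_eq k_inj) (inj_eq enum_val_inj).
  rewrite -[leqLHS](size_tuple (mktuple w)) -(eqP fr); apply: dimvS.
  by apply/span_subvP=> v /mapP[j _ ->]; apply: (wP j).1.
have r_lin : linear (fun v => \row_(j < #|lead A|) (v (enum_val j) : F)).
  by move=> a x y; apply/rowP=> j; rewrite !mxE !ffunE.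
pose rL := GRing.isLinear.Build F _ _ *:%R _ r_lin.
pose rl : {linear {ffun I -> F^o} -> 'rV[F]_#|lead A|} :=
  HB.pack (fun v => \row_(j < #|lead A|) (v (enum_val j) : F)) rL.
rewrite -(@limg_dim_eq _ _ _ (linfun rl)).
  by rewrite (leq_trans (dimvS (subvf _))) // dimvf dim_matrix mul1r leqnn.
apply/eqP; rewrite -subv0; apply/subvP=> v /memv_capP[vA].
rewrite memv_ker lfunE /= memv0 => /eqP v0.
apply/negPn/negP => vn0.
have [i vi] : exists i, v i != 0.
  apply/existsP; apply: contraNT vn0; rewrite negb_exists => /forallP h.
  by apply/eqP/ffunP=> i; rewrite ffunE; apply/eqP; move: (h i); rewrite negbK.
case: (@arg_maxnP _ i (fun i => v i != 0) k vi) => m vm mmax.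
have mA : m \in lead A.
  apply/leadP; exists v => //; split=> // j; rewrite ltnNge => h.
  by apply/eqP/negPn/negP => vj; move/negP: h; apply; apply: mmax.
move/rowP/(_ (enum_rank_in mA m)): v0; rewrite !mxE enum_rankK_in // => /eqP.
by rewrite (negbTE vm).
Qed.
End LeadingSet.

(** * A weight on finite sets that is compatible with insertion *)

Section Weight.
Variables (C : finType) (A0 : {set C}).
Implicit Types T : {set C}.
Local Open Scope nat_scope.

Lemma bits_inj N (f g : nat -> bool) :
  \sum_(i < N) f i * 2 ^ i = \sum_(i < N) g i * 2 ^ i ->
  forall i, i < N -> f i = g i.
Proof.
elim: N f g => [//|N IH] f g.
have step (h : nat -> bool) : \sum_(i < N.+1) h i * 2 ^ i
    = h 0 + (\sum_(i < N) h i.+1 * 2 ^ i).*2.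
  rewrite big_ord_recl muln1 -muln2 big_distrl; congr (_ + _).
  by apply: eq_bigr => i _; rewrite lift0 expnSr mulnA.
rewrite !step => e.
have e0 : f 0 = g 0.
  by move/(congr1 odd): e; rewrite !oddD !odd_double !addbF !oddb.
move: e; rewrite e0 => /addnI/double_inj e [|i] //.
exact: (IH (f \o succn) (g \o succn) e).
Qed.

Lemma bits_lt N (f : nat -> bool) : \sum_(i < N) f i * 2 ^ i < 2 ^ N.
Proof.
elim: N => [|N IH]; first by rewrite big_ord0.
rewrite big_ord_recr /= expnS mul2n -addnn -addSn leq_add //.
by case: (f N); rewrite ?mul1n ?mul0n.
Qed.

Definition setweight T := \sum_(c in T) 2 ^ enum_rank c.

Lemma setweightE T : exists2 f : nat -> bool,
  setweight T = \sum_(i < #|C|) f i * 2 ^ i &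
  forall c, (c \in T) = f (enum_rank c).
Proof.
exists (fun i => [exists c, (c \in T) && (i == enum_rank c :> nat)]);
  last first.
  move=> c; apply/idP/existsP => [cT|[c' /andP[cT /eqP/val_inj/enum_rank_inj ->
    //]]].
  by exists c; rewrite cT eqxx.
rewrite /setweight.
rewrite (reindex_onto (fun i : 'I_#|C| => enum_val i) enum_rank) /=; last first.
  by move=> c _; rewrite enum_rankK.
rewrite big_mkcond /=; apply: eq_bigr => i _; rewrite enum_valK eqxx andbT.
have -> : [exists c, (c \in T) && (i == enum_rank c :> nat)] =
    (enum_val i \in T).
  apply/existsP/idP => [[c /andP[cT /eqP/val_inj ->]]|iT];
    first by rewrite enum_rankK.
  by exists (enum_val i); rewrite iT enum_valK eqxx.
by case: ifP; rewrite ?mul1n.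
Qed.

(** The number of elements in [A0] takes precedence; ties are resolved by
    reading a set as a binary number.  Weights are additive over disjoint
    unions, whence [weight_ltU1]. *)
Definition weight T := #|T :&: A0| * 2 ^ #|C| + setweight T.

Lemma setweight_lt T : setweight T < 2 ^ #|C|.
Proof. by have [f -> _] := setweightE T; apply: bits_lt. Qed.

Lemma weight_inj : injective weight.
Proof.
move=> T T' /(congr1 (modn^~ (2 ^ #|C|))).
rewrite /weight !modnMDl !modn_small ?setweight_lt // => e.
have [f ef fT] := setweightE T; have [g eg gT] := setweightE T'.
apply/setP=> c; rewrite fT gT; apply: (@bits_inj #|C|); last exact: ltn_ord.
by rewrite -ef -eg.
Qed.

Lemma weight_card T T' : weight T < weight T' -> #|T :&: A0| <= #|T' :&: A0|.
Proof.
apply: contraTT; rewrite -ltnNge -leqNgt => h.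
apply: leq_trans (leq_addr _ _).
apply: leq_trans (_ : #|T' :&: A0|.+1 * 2 ^ #|C| <= _); last first.
  by rewrite leq_mul2r h orbT.
by rewrite mulSn addnC /weight leq_add2l ltnW // setweight_lt.
Qed.

Lemma weight_setU1 c T :
  c \notin T -> weight (c |: T) = weight [set c] + weight T.
Proof.
move=> cT; rewrite /weight /setweight big_setU1 //= big_set1 setIUl.
rewrite cardsU (_ : ([set c] :&: A0) :&: (T :&: A0) = set0) ?cards0 ?subn0;
  last first.
  apply/setP=> x; rewrite !inE; case: eqVneq => //= ->.
  by rewrite (negbTE cT) andbF.
by rewrite mulnDl addnACA.
Qed.

Lemma weight_ltU1 c T T' : c \notin T -> c \notin T' ->
  (weight (c |: T) < weight (c |: T')) = (weight T < weight T').
Proof. by move=> cT cT'; rewrite !weight_setU1 // ltn_add2l. Qed.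
End Weight.

(** * A weak form of the Kruskal-Katona theorem *)

Section KruskalKatona.
Local Open Scope nat_scope.
Variable C : finType.
Implicit Types (S D : {set {set C}}) (T : {set C}).

Definition link x S := [set T :\ x | T in [set T in S | x \in T]].

Lemma in_link x S T : (T \in link x S) = (x \notin T) && (x |: T \in S).
Proof.
apply/imsetP/andP => [[T' h ->]|[xT TS]].
  by move: h; rewrite inE => /andP[TS xT]; rewrite setD11 setD1K.
by exists (x |: T); [rewrite inE TS setU11 | rewrite setU1K].
Qed.

(** Double counting of the pairs of a set of the family and one of its
    elements. *)
Lemma sum_card_link S k : (forall T, T \in S -> #|T| = k) ->
  \sum_x #|link x S| = k * #|S|.
Proof.
move=> Sk.
transitivity (\sum_(T in S) \sum_(x in T) 1); last first.
  rewrite mulnC -sum_nat_const; apply: eq_bigr => T TS.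
  by rewrite sum1_card Sk.
rewrite (exchange_big_dep predT) //=; apply: eq_bigr => x _.
rewrite card_in_imset ?sum1_card; first by apply: eq_card => T; rewrite !inE.
move=> T T'; rewrite !inE => /andP[_ xT] /andP[_ xT'] e.
by rewrite -(setD1K xT) e setD1K.
Qed.

(** By induction on links.  The link of [x] in [S] has its shadow inside the
    link of [x] in [D], and is itself contained in [D].  Averaging over [x]
    provides a link where the ratio of the sizes is at least |S| / |D|; there
    both estimates combine. *)
Lemma shadow_bound S D k : S != set0 ->
  (forall T, T \in S -> #|T| = k.+1) -> (forall T, T \in D -> #|T| = k) ->
  (forall T x, T \in S -> x \in T -> T :\ x \in D) ->
  #|S| ^ k <= #|D| ^ k.+1.
Proof.
elim: k S D => [|k IH] S D S0 Sk Dk sh.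
  have [T TS] := set0Pn _ S0.
  have [x xT] : exists x, x \in T by apply/set0Pn; rewrite -card_gt0 Sk.
  by rewrite expn1 card_gt0; apply/set0Pn; exists (T :\ x); apply: sh.
have S_gt0 : 0 < #|S| by rewrite card_gt0.
have D_gt0 : 0 < #|D|.
  have [T TS] := set0Pn _ S0.
  have [x xT] : exists x, x \in T by apply/set0Pn; rewrite -card_gt0 Sk.
  by rewrite card_gt0; apply/set0Pn; exists (T :\ x); apply: sh.
(* Otherwise summing over all x contradicts the double counting, where the
   two sums carry the factors k + 2 and k + 1. *)
have [x Sx0 le_x] : exists2 x, link x S != set0 &
    #|link x D| * #|S| <= #|link x S| * #|D|.
  apply/exists_inP; apply: contraT; rewrite negb_exists_in => /forall_inP no.
  have : \sum_x #|link x S| * #|D| <= \sum_x #|link x D| * #|S|.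
    apply: leq_sum => x _; have [->|Sx] := eqVneq (link x S) set0.
      by rewrite cards0.
    by apply: ltnW; rewrite ltnNge; apply: no.
  rewrite -!big_distrl /= (sum_card_link Sk) (sum_card_link Dk).
  rewrite -!mulnA [#|D| * #|S|]mulnC leq_pmul2r ?muln_gt0 ?S_gt0 ?D_gt0 //.
  by rewrite ltnn.
have links x' (R : {set {set C}}) j : (forall T, T \in R -> #|T| = j.+1) ->
    forall T, T \in link x' R -> #|T| = j.
  move=> Rj T; rewrite in_link => /andP[xT /Rj].
  by rewrite cardsU1 xT => -[].
have sub : link x S \subset D.
  by apply/subsetP=> _ /imsetP[T + ->]; rewrite inE => /andP[TS xT]; apply: sh.
have {}IH : #|link x S| ^ k <= #|link x D| ^ k.+1.
  apply: IH => //; [exact: links|exact: links|] => T y.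
  rewrite !in_link !inE => /andP[xT TS] yT; rewrite negb_and xT orbT /=.
  have xy : x != y by apply: contraNneq xT => ->.
  have -> : x |: T :\ y = (x |: T) :\ y.
    by apply/setP=> z; rewrite !inE; case: (eqVneq z x) => //= ->; rewrite xy.
  by apply: sh => //; rewrite !inE yT orbT.
have Dx_gt0 : 0 < #|link x D| ^ k.+1.
  by apply: leq_trans IH; rewrite expn_gt0 card_gt0 Sx0.
rewrite -(leq_pmul2l Dx_gt0) -expnMn.
apply: leq_trans (_ : (#|link x S| * #|D|) ^ k.+1 <= _).
  by rewrite leq_exp2r.
rewrite expnMn [#|link x S| ^ _]expnSr -mulnA [#|D| ^ k.+2]expnS;
  apply: leq_mul => //.
by rewrite leq_mul2r subset_leq_card ?orbT.
Qed.
End KruskalKatona.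

(** * Sources and sinks in acyclic digraphs *)

Section Acyclic.
Local Open Scope nat_scope.
Variables (T : finType) (G : digraph T).
Hypothesis acG : acyclic G.

Lemma acyclic_connect u v : arc G u v -> ~~ connect (arc G) v u.
Proof.
move=> uv; apply/negP => /connectP[p pth e].
case/shortenP: pth e => p' pth' uq _ e.
suff: v :: p' = [::] by [].
apply: acG; rewrite /ucycle uq andbT.
by rewrite /= rcons_path pth' -e.
Qed.

(** A member of [X] with the fewest ancestors. *)
Lemma acyclic_source (X : {set T}) : X != set0 ->
  exists2 u, u \in X & forall v, arc G v u -> v \notin X.
Proof.
case/set0Pn=> u0 u0X.
case: (arg_minnP (fun u => #|[set w | connect (arc G) w u]|) u0X) => u uX umin.
exists u => // v vu; apply/negP => /umin; rewrite leqNgt => /negP; apply.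
apply: proper_card; apply/properP; split.
  by apply/subsetP=> w; rewrite !inE => /connect_trans; apply; apply: connect1.
by exists u; rewrite !inE ?connect0 //; apply: acyclic_connect.
Qed.

(** A member of [X] with the fewest descendants. *)
Lemma acyclic_sink (X : {set T}) : X != set0 ->
  exists2 u, u \in X & forall v, arc G u v -> v \notin X.
Proof.
case/set0Pn=> u0 u0X.
case: (arg_minnP (fun u => #|[set w | connect (arc G) u w]|) u0X) => u uX umin.
exists u => // v uv; apply/negP => /umin; rewrite leqNgt => /negP; apply.
apply: proper_card; apply/properP; split.
  by apply/subsetP=> w; rewrite !inE; apply: connect_trans; apply: connect1.
by exists u; rewrite !inE ?connect0 //; apply: acyclic_connect.
Qed.
End Acyclic.

(** * Combinatorics of pedigrees *)

Section PedigreeStructure.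
Local Open Scope nat_scope.
Variables (n d m l s : nat) (G : digraph {set 'I_n}) (o : {set 'I_n}).
Hypothesis hG : pedigree d m l s G o.
Local Notation V := (vertices G).

Definition internal := [set u in V | outdeg G u == d.+1].
Definition leaves := [set u in V | outdeg G u == 0].
Definition labels := \bigcup_(u in V) u.

(** For an internal vertex, the (d + 2)-set whose facets are the vertex and its
    children. *)
Definition cell (u : {set 'I_n}) :=
  if [pick z | (z \notin u) &&
      (out_nbrs G u == [set z |: (u :\ x) | x in u])]
  is Some z then z |: u else u.

Lemma arc_vertices u v : arc G u v -> (u \in V) && (v \in V).
Proof. by move/(subsetP (edges_sub G)); rewrite inE. Qed.

Lemma setU1D1 z (u : {set 'I_n}) x : z \notin u -> x \in u ->
  z |: (u :\ x) = (z |: u) :\ x.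
Proof.
move=> zu xu; apply/setP=> y; rewrite !inE.
by case: (eqVneq y z) => //= ->; rewrite andbT; apply/esym;
  apply: contraNneq zu => ->.
Qed.

Lemma cellP u : u \in internal -> exists z, [/\ z \notin u, cell u = z |: u &
  forall v, arc G u v = [exists x in u, v == cell u :\ x]].
Proof.
rewrite inE => /andP[uV /eqP ou]; rewrite /cell.
case: pickP => [z /andP[zu /eqP e]|no]; last first.
  have [z zu e] := ped_stacking hG uV ou.
  by move: (no z); rewrite zu e eqxx.
exists z; split=> // v; transitivity (v \in out_nbrs G u); first by rewrite inE.
rewrite e; apply/imsetP/exists_inP => [[x xu ->]|[x xu /eqP ->]];
  exists x => //.
  by rewrite setU1D1.
by rewrite setU1D1.
Qed.

Lemma cell_card u : u \in internal -> #|cell u| = d.+2.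
Proof.
move=> uI; have [z [zu -> _]] := cellP uI.
by rewrite cardsU1 zu (ped_card hG) //; case/setIdP: uI.
Qed.

Lemma cell_face u x : u \in internal -> x \in cell u ->
  cell u :\ x = u \/ arc G u (cell u :\ x).
Proof.
move=> uI; have [z [zu e a]] := cellP uI.
rewrite a e inE => /orP[/set1P ->|xu]; first by left; rewrite setU1K.
by right; apply/exists_inP; exists x.
Qed.

Lemma cell_face_vertex u x :
  u \in internal -> x \in cell u -> cell u :\ x \in V.
Proof.
move=> uI xw; case: (cell_face uI xw) => [->|/arc_vertices/andP[] //].
by case/setIdP: uI.
Qed.

Lemma cell_sub_labels u : u \in internal -> cell u \subset labels.
Proof.
move=> uI; apply/subsetP=> x xw.
have [y yw yx] : exists2 y, y \in cell u & y != x.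
  have : 0 < #|cell u :\ x|.
    by move: (cell_card uI); rewrite (cardsD1 x) xw add1n => -[->].
  by rewrite card_gt0 => /set0Pn[y]; rewrite !inE => /andP[yx yw]; exists y.
apply/bigcupP; exists (cell u :\ y); first exact: cell_face_vertex.
by rewrite !inE eq_sym yx.
Qed.

(** The only vertices contained in a cell are its facets, because all vertices
    have the same size. *)
Lemma sub_cell u v :
  u \in internal -> v \in V -> v \subset cell u ->
  v = u \/ arc G u v.
Proof.
move=> uI vV vw.
have : #|cell u :\: v| = 1.
  by rewrite cardsDS // cell_card // (ped_card hG) // subSn ?subnn.
move/eqP/cards1P => [x ex].
have /setDP[xw _] : x \in cell u :\: v by rewrite ex set11.
have -> : v = cell u :\ x.
  by rewrite -ex setDDr setDv set0U; apply/esym/setIidPr.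
exact: cell_face.
Qed.

(** Internal vertices and leaves are m + l in number, which is the number of all
    vertices. *)
Lemma internal_or_leaf u : u \in V -> (u \in internal) || (u \in leaves).
Proof.
have e : internal :|: leaves = V.
  apply/eqP; rewrite eqEcard; apply/andP; split.
    by apply/subsetP=> v; rewrite !inE; case: (v \in V).
  rewrite cardsU (ped_internal hG) (ped_leaves hG) (ped_order hG).
  rewrite (_ : _ :&: _ = set0) ?cards0 ?subn0 //.
  by apply/setP=> v; rewrite !inE; case: eqP => [->|]; rewrite ?andbF // andbF.
by rewrite -in_setU e.
Qed.

Lemma arc_internal u v : arc G u v -> u \in internal.
Proof.
move=> uv; have /andP[uV _] := arc_vertices uv.
case/orP: (internal_or_leaf uV) => //; rewrite inE /outdeg cards_eq0.
by case/andP=> _ /eqP/setP/(_ v); rewrite !inE uv.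
Qed.

(** Every vertex can be reached from the root, the only source; hence this
    induction principle. *)
Lemma root_ind (P : {set 'I_n} -> Prop) : P o ->
  (forall u v, P u -> arc G u v -> P v) -> forall u, u \in V -> P u.
Proof.
move=> Po step u uV; apply: contrapT => Pu.
pose X := [set u in V | `[< ~ P u >]].
have /(acyclic_source (ped_acyclic hG))[v] : X != set0.
  by apply/set0Pn; exists u; rewrite inE uV; apply/asboolP.
rewrite inE => /andP[vV /asboolP Pv] src.
have [e|vo] := eqVneq v o; first by apply: Pv; rewrite e.
have : indeg G v <> 0 by move/(ped_root hG vV)/eqP; rewrite (negbTE vo).
move/eqP; rewrite -lt0n card_gt0 => /set0Pn[w]; rewrite inE => wv.
move: (src w wv); rewrite inE; have /andP[-> _] := arc_vertices wv.
by move/asboolPn; rewrite notK => Pw; apply: Pv; apply: step wv.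
Qed.

Lemma card_edges : #|edges G| = d.+1 * m.
Proof.
transitivity (\sum_(u in V) outdeg G u).
  rewrite (eq_bigr (fun u => \sum_(v | arc G u v) 1)); last first.
    by move=> u _; rewrite sum1_card /outdeg; apply: eq_card => v; rewrite inE.
  rewrite pair_big_dep /= sum1_card; apply: eq_card => -[u v];
    rewrite unfold_in /=.
  by apply/idP/andP=> [uv|[]//]; have /andP[] := arc_vertices uv.
rewrite (bigID (mem internal)) /= [X in _ + X]big1 ?addn0; last first.
  by move=> u /andP[/internal_or_leaf/orP[->//|]]; rewrite inE => /andP[_ /eqP].
rewrite (eq_bigr (fun=> d.+1)); last by move=> u /andP[_];
  rewrite inE => /andP[_ /eqP].
rewrite sum_nat_const mulnC -(ped_internal hG); congr (_ * _).
by apply: eq_card => u; rewrite unfold_in /= !inE; case: (u \in V).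
Qed.
End PedigreeStructure.

(** * Spans of indexed families *)

Section SpanImage.
Variables (F : fieldType) (vT : vectType F) (I : finType).
Variables (f : I -> vT) (M : {set I}).

Definition span_image := <<[tuple f (enum_val j) | j < #|M|]>>%VS.

Lemma mem_span_image i : i \in M -> f i \in span_image.
Proof.
move=> iM; apply/memv_span/mapP; exists (enum_rank_in iM i);
  rewrite ?mem_enum //.
by rewrite enum_rankK_in.
Qed.

Lemma span_imageP v :
  v \in span_image ->
  exists a : I -> F, v = \sum_(i in M) a i *: f i.
Proof.
move=> /coord_span ->.
have [M0 |[i0 iM]] := set_0Vmem M.
  exists (fun=> 0); rewrite [RHS]big1 ?big1 // => [j _|i _];
    last exact: scale0r.
  by have := enum_valP j; rewrite {2}M0 inE.
exists (fun i => coord [tuple f (enum_val j) | j < #|M|] (enum_rank_in iM i) v).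
rewrite [RHS]big_enum_val; apply: eq_bigr => j _.
by rewrite nth_mktuple enum_valK_in.
Qed.

Lemma dim_span_image : (\dim span_image <= #|M|)%N.
Proof. by rewrite (leq_trans (dim_span _)) // size_tuple. Qed.

Lemma dim_span_image_free : (forall a : I -> F, \sum_(i in M) a i *: f i = 0 ->
  forall i, i \in M -> a i = 0) -> \dim span_image = #|M|.
Proof.
move=> h; suff /eqP -> : free [tuple f (enum_val j) | j < #|M|].
  by rewrite size_tuple.
apply/freeP=> c c0 j.
have jM := enum_valP j.
rewrite -(enum_valK_in jM j).
apply: (h (fun i => c (enum_rank_in jM i))) => //.
rewrite -[RHS]c0 [LHS]big_enum_val; apply: eq_bigr => i _.
by rewrite nth_mktuple enum_valK_in.
Qed.
End SpanImage.

(** * Volume vectors *)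

Section Forms.
Variables (F : fieldType) (n d : nat) (t : 'I_n -> F) (Y : {set 'I_n}).
Hypotheses (char2 : 2 \in [pchar F]) (t_inj : injective t).
Implicit Types (u w : {set 'I_n}) (j : 'I_d) (y : 'I_n).
Local Notation C := ('I_d + 'I_n)%type.
Implicit Type T : {set C}.

Definition one : {ffun 'I_n -> F} := [ffun=> 1].

(** The coordinates of the labels: the coordinates [inl j] place label x at the
    point (t x, ..., t x ^ d) of the moment curve, and [inr y] is the private
    coordinate of a label y in [Y].  It vanishes identically for y outside [Y],
    so that such an index never occurs in a set with a nonzero volume. *)
Definition axis (c : C) : {ffun 'I_n -> F} := match c with
  | inl j => [ffun x => t x ^+ j.+1]
  | inr y => [ffun x => ((y \in Y) && (y == x))%:R] end.

(** At a set [T] of coordinates, the volume of the projection of the simplex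
    [u] to these coordinates (times d factorial): a determinant with a
    column of ones. *)
Definition vol u : {ffun {set C} -> F^o} :=
  [ffun T : {set C} => permanent u (one :: [seq axis c | c <- enum T])].

Definition axes : {set C} := [set inl j | j : 'I_d].

Lemma vol_card u T : vol u T != 0 -> #|u| = #|T|.+1.
Proof.
by rewrite ffunE => /permanent_neq0_card ->; rewrite /= size_map cardE.
Qed.

Lemma vol_label u T y : vol u T != 0 -> inr y \in T -> (y \in Y) /\ (y \in u).
Proof.
rewrite ffunE => nz yT; apply/andP; apply: contraNT nz => yYu.
apply/eqP; apply: (@permanent_vanish _ _ _ (axis (inr y))).
  by rewrite inE map_f ?orbT // mem_enum.
move=> x xu; rewrite ffunE; case: (eqVneq y x) => [e|]; rewrite ?andbF //.
by move: yYu; rewrite e xu andbT => /negbTE ->.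
Qed.

Lemma vol_setU1 c u T : c \notin T ->
  vol u (c |: T) = permanent u (axis c :: one :: [seq axis c' | c' <- enum T]).
Proof.
move=> cT; rewrite ffunE permanent_swap; apply: (@permanent_perm F);
  rewrite perm_cons.
rewrite -[_ :: map _ _]/(map axis (c :: enum T)); apply: perm_map.
apply: uniq_perm; rewrite /= ?enum_uniq // ?mem_enum ?cT //.
by move=> x; rewrite !inE !mem_enum !inE.
Qed.

Lemma expand_vol u T (g : {ffun 'I_n -> F}) :
  \sum_(x in u) g x * vol (u :\ x) T =
  permanent u (g :: one :: [seq axis c' | c' <- enum T]).
Proof. by rewrite /=; apply: eq_bigr => x _; rewrite ffunE. Qed.

Lemma expand_vol_axis c u T : \sum_(x in u) axis c x * vol (u :\ x) T =
  if c \in T then 0 else vol u (c |: T).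
Proof.
rewrite expand_vol; case: ifPn => [cT|cT]; last by rewrite vol_setU1.
by apply: permanent_dup_in => //; rewrite inE map_f ?orbT ?mem_enum.
Qed.

(** The boundary relation: a determinant with two columns of ones is 0. *)
Lemma sum_vol_facets u T : \sum_(x in u) vol (u :\ x) T = 0.
Proof.
transitivity (\sum_(x in u) one x * vol (u :\ x) T).
  by apply: eq_bigr => x _; rewrite [one x]ffunE mul1r.
by rewrite expand_vol permanent_dup.
Qed.

(** The points of the moment curve are in general position, by Vandermonde. *)
Lemma vol_axes u : #|u| = d.+1 -> vol u axes != 0.
Proof.
move=> ud; have := permanent_vandermonde char2 t_inj ud.
rewrite ffunE (permanent_perm _ (_ : perm_eq (one :: _)
  [seq [ffun x => t x ^+ val i] | i <- enum 'I_d.+1])) //.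
rewrite enum_ordSl /= (_ : [ffun x => _] = one); last by apply/ffunP=> x;
  rewrite !ffunE expr0.
rewrite perm_cons -map_comp.
have -> : [seq ((fun i : 'I_d.+1 => [ffun x => t x ^+ val i])
                  \o lift ord0) i | i <- enum 'I_d] =
   map axis (map inl (enum 'I_d)).
  by rewrite -[RHS]map_comp; apply: eq_map => j /=; apply/ffunP=> x;
    rewrite !ffunE.
apply/perm_map/uniq_perm; rewrite ?enum_uniq //.
  by rewrite map_inj_uniq ?enum_uniq // => ? ? [].
move=> c; rewrite mem_enum; apply/imsetP/mapP => [[j _ ->]|[j _ ->]];
  exists j => //.
by rewrite mem_enum.
Qed.
End Forms.

(** * The spaces spanned by leaves and by cells *)

Section Spaces.
Variables (F : fieldType) (n d m l s : nat) (t : 'I_n -> F).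
Variables (G : digraph {set 'I_n}) (o : {set 'I_n}).
Hypotheses (char2 : 2 \in [pchar F]) (t_inj : injective t).
Hypothesis hG : pedigree d m l s G o.
Implicit Types (u w : {set 'I_n}) (i j : 'I_d) (y : 'I_n).
Local Notation C := ('I_d + 'I_n)%type.
Implicit Type T : {set C}.
Local Notation V := (vertices G).
Let Y := labels G :\: o.
Local Notation vol := (@vol F n d t Y).
Local Notation axis := (@axis F n d t Y).
Local Notation one := (@one F n).
Local Notation axes := (@axes n d).
Local Notation internal := (internal d G).
Local Notation leaves := (leaves G).
Local Notation cell := (cell G).
Local Notation weight := (weight axes).

Definition leaf_span := span_image vol leaves.
Definition cell_span := span_image (vol \o cell) internal.

Lemma root_sub : o \subset labels G.
Proof.
by apply/subsetP=> x xo; apply/bigcupP; exists o => //; apply: (ped_root_in hG).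
Qed.

Lemma card_new_labels : #|Y| = s.
Proof.
rewrite cardsDS ?root_sub // /labels (ped_labels hG) (ped_card hG)
  ?(ped_root_in hG) //.
by rewrite addn1 -addnS addnK.
Qed.

(** Otherwise take a counterexample none of whose children is one: if it is
    internal, the boundary relation of its cell expresses its volume vector by
    those of its children. *)
Lemma vol_leaf_span u : u \in V -> vol u \in leaf_span.
Proof.
move=> uV; apply: contrapT => uB.
pose X := [set v in V | vol v \notin leaf_span].
have /(acyclic_sink (ped_acyclic hG))[v] : X != set0.
  by apply/set0Pn; exists u; rewrite inE uV; apply/negP.
rewrite inE => /andP[vV /negP vB] sink; apply: vB.
case/orP: (internal_or_leaf hG vV) => [vI|vL]; last exact: mem_span_image.
have [z [zv e a]] := cellP hG vI.
have -> : vol v = \sum_(x in v) vol (cell v :\ x).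
  apply/ffunP=> T; have := sum_vol_facets (d:=d) t Y char2 (cell v) T.
  rewrite {1}e big_setU1 //= e setU1K // => /eqP.
  by rewrite addr_eq0 (oppr_pchar2 char2) sum_ffunE => /eqP.
apply: memv_suml => x xv.
have vx : arc G v (cell v :\ x) by rewrite a; apply/exists_inP; exists x.
move: (sink _ vx); rewrite inE negb_and negbK.
by have /andP[_ ->] := arc_vertices vx.
Qed.

Lemma dim_leaf_span : (\dim leaf_span <= l)%N.
Proof. by rewrite (leq_trans (dim_span_image _ _)) // -(ped_leaves hG). Qed.

Lemma leaf_span_support v T : v \in leaf_span -> v T != 0 ->
  #|T| = d /\ forall y, inr y \in T -> y \in Y.
Proof.
move=> /span_imageP[a ->] nz.
have [u uL fu] : exists2 u, u \in leaves & vol u T != 0.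
  apply/exists_inP; apply: contraNT nz; rewrite negb_exists_in => /forall_inP h.
  rewrite sum_ffunE big1 // => u uL; rewrite ffunE.
  by have := h _ uL; rewrite negbK => /eqP ->; rewrite scaler0.
split=> [|y yT]; last by have [] := vol_label fu yT.
have := vol_card fu; rewrite (ped_card hG) //; first by case.
by case/setIdP: uL.
Qed.

Lemma cell_span_support v T : v \in cell_span -> v T != 0 ->
  #|T| = d.+1 /\ forall y, inr y \in T -> y \in Y.
Proof.
move=> /span_imageP[a ->] nz.
have [u uL fu] : exists2 u, u \in internal & vol (cell u) T != 0.
  apply/exists_inP; apply: contraNT nz; rewrite negb_exists_in => /forall_inP h.
  rewrite sum_ffunE big1 // => u uL; rewrite ffunE.
  by have := h _ uL; rewrite negbK => /eqP /= ->; rewrite scaler0.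
split=> [|y yT]; last by have [] := vol_label fu yT.
by have := vol_card fu; rewrite (cell_card hG) // => -[].
Qed.

(** Laplace expansion along the column [c] turns a volume vector of cells into a
    combination of volume vectors of their facets, hence into an element of
    [leaf_span].  On coordinates this operation is T |-> c |: T, which respects
    the order of weights, so leading sets go to leading sets. *)
Lemma lead_shadow T c : T \in lead weight cell_span -> c \in T ->
  T :\ c \in lead weight leaf_span.
Proof.
case/leadP=> v vA [vT vmax] cT.
(* A column that occurs twice gives 0, hence the case distinction. *)
pose b : {ffun {set C} -> F^o} :=
  [ffun T : {set C} => if c \in T then 0 else v (c |: T)].
apply/leadP; exists b; last first.
  split=> [|T']; first by rewrite ffunE setD11 setD1K.
  rewrite ffunE; case: ifPn => // cT' lt; apply: vmax.
  by rewrite -{1}(setD1K cT) weight_ltU1 ?setD11.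
have [a ea] := span_imageP vA.
have -> : b = \sum_(u in internal) a u *:
    \sum_(x in cell u) (axis c x : F) *: vol (cell u :\ x).
  apply/ffunP=> T'; rewrite sum_ffunE.
  transitivity (\sum_(u in internal) a u *
      (if c \in T' then 0 else vol (cell u) (c |: T'))).
    rewrite ffunE; case: ifP => _; first by rewrite big1 // => u _;
      rewrite mulr0.
    by rewrite ea sum_ffunE; apply: eq_bigr => u _; rewrite ffunE.
  apply: eq_bigr => u _; rewrite [RHS]ffunE sum_ffunE -expand_vol_axis //;
    congr (_ * _).
  by apply: eq_bigr => x _; rewrite [RHS]ffunE.
apply: memv_suml => u uI; apply/memvZ/memv_suml => x xu; apply/memvZ.
by apply: vol_leaf_span; apply: (cell_face_vertex hG).
Qed.

Definition axes_swap j y : {set C} := inr y |: (axes :\ inl j).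

(** The sets of [d] coordinates, with labels in [Y], that contain at least
    d - 1 axes; see [near_axesP]. *)
Definition near_axes : {set {set C}} :=
  axes |: [set axes_swap p.1 p.2 | p in setX setT Y].

Lemma inl_axes j : inl j \in axes.
Proof. exact: imset_f. Qed.

Lemma inr_axes y : inr y \in axes = false.
Proof. by apply/imsetP=> -[]. Qed.

Lemma card_axes : #|axes| = d.
Proof. by rewrite card_imset ?card_ord // => ? ? []. Qed.

Lemma near_axesP T : #|T| = d -> (d.-1 <= #|T :&: axes|)%N ->
  (forall y, inr y \in T -> y \in Y) -> T \in near_axes.
Proof.
move=> Td; rewrite leq_eqVlt => /orP[/eqP e|lt] TY; last first.
  have le : (d <= #|T :&: axes|)%N by apply: leq_trans (leqSpred d) lt.
  rewrite inE; apply/orP; left; rewrite inE; apply/eqP.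
  have e1 : T :&: axes = T by apply/eqP; rewrite eqEcard subsetIl Td.
  have e2 : T :&: axes = axes by apply/eqP; rewrite eqEcard subsetIr card_axes.
  by rewrite -e1 e2.
have [d0|d_gt0] := posnP d.
  rewrite inE; apply/orP; left; rewrite inE; apply/eqP.
  have /cards0_eq -> : #|T| = 0 by rewrite Td.
  by apply/esym/cards0_eq; rewrite card_axes.
have /eqP/cards1P[c ec] : #|T :\: axes| = 1.
  by rewrite cardsD Td -e; case: (d) d_gt0 => // d' _; rewrite subSn ?subnn.
have /eqP/cards1P[c' ec'] : #|axes :\: T| = 1.
  by rewrite cardsD card_axes setIC -e; case: (d) d_gt0 => // d' _;
    rewrite subSn ?subnn.
have /setDP[cT cA] : c \in T :\: axes by rewrite ec set11.
have /setDP[c'A c'T] : c' \in axes :\: T by rewrite ec' set11.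
case: c cT cA ec => [j|y] cT cA ec; first by rewrite inl_axes in cA.
have /imsetP[j _ ej] := c'A; rewrite {}ej in c'A c'T ec'.
rewrite inE; apply/orP; right; apply/imsetP; exists (j, y);
  first by rewrite in_setX in_setT TY.
rewrite /axes_swap /= -ec -ec' setDDr setDv set0U setIC setUC; apply/esym.
by rewrite setID.
Qed.

Lemma card_near_axes : #|near_axes| = (d * s).+1.
Proof.
rewrite cardsU1 card_in_imset.
  rewrite cardsX cardsT card_ord card_new_labels;
    case: imsetP => //= -[[j y] _ e].
  by have := inr_axes y; rewrite e setU11.
move=> [j y] [j' y'] _ _ /= e.
have ey : y = y'.
  have : inr y \in axes_swap j' y' by rewrite -e setU11.
  by rewrite inE inE => /orP[/eqP[->]//|]; rewrite inE inr_axes andbF.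
suff -> : j = j' by rewrite ey.
apply/eqP; apply: contraT => jj.
have : inl j \in axes_swap j' y' by rewrite inE !inE jj inl_axes orbT.
by rewrite -e inE !inE eqxx.
Qed.

(** When all members of [near_axes] are spikes, [leaf_span] restricts onto these
    coordinates, so they can all be leading. *)
Definition spike T := exists2 v, v \in leaf_span &
  forall T', T' \in near_axes -> v T' = (T' == T)%:R.

(** Elimination: known spikes clear all other coordinates of [v]. *)
Lemma spike_reduce v T0 : v \in leaf_span -> T0 \in near_axes -> v T0 != 0 ->
  (forall T, T \in near_axes -> T != T0 -> v T = 0 \/ spike T) -> spike T0.
Proof.
move=> vB T0top v0 h.
have /choice[f fP] T : exists f, f \in leaf_span /\
    (T \in near_axes -> T != T0 -> v T = 0 \/
      forall T', T' \in near_axes -> f T' = (T' == T)%:R).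
  have [[f fB fT]|no] := pselect (spike T).
    by exists f; split=> // _ _; right.
  exists 0; split; first exact: mem0v.
  by move=> Tt TT0; case: (h T Tt TT0) => [->|//]; left.
exists ((v T0)^-1 *: (v - \sum_(T in near_axes :\ T0) (v T : F) *: f T)).
  by apply/memvZ/memvB => //; apply/memv_suml => T _; apply/memvZ;
    apply: (fP T).1.
move=> T' T't; rewrite !ffunE sum_ffunE.
have e T : T \in near_axes :\ T0 -> ((v T : F) *: f T) T' = v T * (T' == T)%:R.
  rewrite in_setD1 => /andP[TT0 Tt]; rewrite ffunE.
  by case: ((fP T).2 Tt TT0) => [->|->//]; rewrite scale0r mul0r.
rewrite (eq_bigr _ e) {e}.
have [->|T'T0] := eqVneq T' T0.
  rewrite big1 ?subr0; first exact: mulVf.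
  by move=> T /setD1P[TT0 _]; rewrite eq_sym (negbTE TT0) mulr0.
rewrite (bigD1 T') /=; last by rewrite in_setD1 T'T0.
rewrite eqxx mulr1 big1 ?addr0 ?subrr ?scaler0 //.
by move=> T /andP[_ TT']; rewrite eq_sym (negbTE TT') mulr0.
Qed.

Lemma axes_near_axes : axes \in near_axes. Proof. exact: setU11. Qed.

Lemma axes_swap_near_axes j y : y \in Y -> axes_swap j y \in near_axes.
Proof.
by move=> yY; apply/setU1P; right; apply/imsetP; exists (j, y);
  rewrite ?in_setX ?in_setT.
Qed.

(** The root has no label in [Y], so in [near_axes] its volume vector is nonzero
    only at [axes]. *)
Lemma spike_axes : spike axes.
Proof.
apply: (spike_reduce (v := vol o)).
- exact: vol_leaf_span (ped_root_in hG).
- exact: axes_near_axes.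
- by apply: vol_axes => //; apply: (ped_card hG) (ped_root_in hG).
move=> T /setU1P[->|/imsetP[[j y]]]; first by rewrite eqxx.
rewrite in_setX /= => /andP[_ /setDP[_ yo]] -> _; left.
apply/eqP; apply: contraNT yo => nz.
by have [] := vol_label nz (setU11 _ _).
Qed.

(** Induction along the arcs from the root.  Suppose that u is internal with
    outgoing label z and that the labels of u are settled.  The volume vectors
    of the children of u, weighted by the j-th coordinates of the removed
    labels, add up to a vector whose entry at [axes_swap i z] is the
    determinant of u with its i-th column replaced by its j-th one.  It is zero
    for i <> j, and nonzero for i = j because the points of u are in general
    position. *)
Lemma spike_axes_swap j y : y \in Y -> spike (axes_swap j y).
Proof.
move=> yY; have /setDP[/bigcupP[u uV yu] _] := yY.
move: u uV j y yY yu; apply: (root_ind hG).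
  by move=> j y /setDP[_ /negP].
move=> u v Qu uv j y yY yv.
have uI := arc_internal hG uv.
have [z [zu e a]] := cellP hG uI.
have [yu|yu] := boolP (y \in u); first exact: Qu.
have yz : y = z.
  move: uv; rewrite a e => /exists_inP[x xu /eqP ev]; move: yv; rewrite ev !inE.
  by rewrite (negbTE yu) orbF => /andP[_ /eqP].
pose b : {ffun {set C} -> F^o} :=
  \sum_(x in u) (axis (inl j) x : F) *: vol (cell u :\ x).
have bT T : b T = \sum_(x in u) axis (inl j) x * vol (cell u :\ x) T.
  by rewrite sum_ffunE; apply: eq_bigr => x _; rewrite ffunE.
have b_swap i : b (axes_swap i y) = if i == j then vol u axes else 0.
  rewrite bT.
  rewrite (eq_bigr (fun x => axis (inl j) x * vol (u :\ x) (axes :\ inl i)));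
    last first.
    move=> x xu; congr (_ * _).
    rewrite vol_setU1 ?inE ?inr_axes ?andbF //.
    rewrite (permanent_indicator (x := y)); first last.
    - by move=> x' _; rewrite ffunE yY.
    - by rewrite e yz !inE eqxx andbT; apply: contraNneq zu => ->.
    rewrite [RHS]ffunE; congr (permanent _ _).
    by rewrite e yz -setU1D1 // setU1K // inE (negbTE zu) andbF.
  rewrite expand_vol_axis //; case: (eqVneq i j) => [->|ij].
    by rewrite setD11 setD1K ?inl_axes.
  by rewrite in_setD1 inl_axes andbT ifT //; apply: contraNneq ij => -[->].
apply: (spike_reduce (v := b)).
- apply: memv_suml => x xu; apply: memvZ; apply: vol_leaf_span.
  by apply: (cell_face_vertex hG) => //; rewrite e inE xu orbT.
- exact: axes_swap_near_axes.
- by rewrite b_swap eqxx vol_axes // (ped_card hG) //; case/setIdP: uI.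
move=> T /setU1P[-> _|/imsetP[[i y']]]; first by right; apply: spike_axes.
rewrite in_setX /= => /andP[_ y'Y] -> ne.
have [y'u|y'u] := boolP (y' \in u); first by right; apply: Qu.
left; have [ey|y'y] := eqVneq y' y.
  rewrite ey b_swap; case: eqVneq => // ij.
  by move: ne; rewrite ey ij eqxx.
rewrite bT big1 // => x xu; apply/eqP; rewrite mulf_eq0; apply/orP; right.
apply: contraT => nz; have [_] := vol_label nz (setU11 _ _).
by rewrite e !inE -yz (negbTE y'y) (negbTE y'u) andbF.
Qed.

(** A set heavier than a member of [near_axes] has at least as many axes, so it
    is in [near_axes] as well or carries no volume. *)
Lemma near_axes_sub_lead : near_axes \subset lead weight leaf_span.
Proof.
apply/subsetP=> T Tt.
have axT : (d.-1 <= #|T :&: axes|)%N.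
  move: Tt => /setU1P[->|/imsetP[[j y] _ ->]];
    first by rewrite setIid card_axes leq_pred.
  rewrite -(leq_add2l 1) (leq_trans (_ : _ <= d)%N) //.
    by rewrite add1n prednK // (leq_ltn_trans _ (ltn_ord j)).
  rewrite -{1}card_axes (cardsD1 (inl j)) inl_axes leq_add2l.
  by rewrite subset_leq_card // subsetI subsetDl /axes_swap subsetU1.
have [v vB vT] : spike T.
  case/setU1P: Tt => [->|/imsetP[[j y]]]; first exact: spike_axes.
  by rewrite in_setX /= => /andP[_ yY] ->; apply: spike_axes_swap.
apply/leadP; exists v => //; split; first by rewrite vT // eqxx oner_neq0.
move=> T' lt; apply/eqP; apply: contraT => nz.
have [T'd T'Y] := leaf_span_support vB nz.
have T't : T' \in near_axes.
  by apply: near_axesP => //; apply: leq_trans axT (weight_card lt).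
by move: nz lt; rewrite vT //; have [->|_] := eqVneq T' T; rewrite ?ltnn ?eqxx.
Qed.
End Spaces.

(** * Independence of the cells *)

Arguments permanent : simpl never.

(** Polynomials of degree less than #|u| in t separate the points of u: apply
    the hypothesis to the product of the X - t y over the other points y. *)
Lemma moments_eq0 (F : fieldType) (I : finType) (t f : I -> F) (u : {set I}) :
  injective t ->
  (forall k, (k < #|u|)%N -> \sum_(x in u) t x ^+ k * f x = 0) ->
  forall x, x \in u -> f x = 0.
Proof.
move=> t_inj f0 x xu.
pose p := \prod_(a <- [seq t y | y <- enum (u :\ x)]) ('X - a%:P).
have p_size : (size p <= #|u|)%N.
  by rewrite (size_prod_XsubC _ id) size_map -cardE (cardsD1 x u) xu.
have : \sum_(y in u) p.[t y] * f y = 0.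
  rewrite (eq_bigr (fun y => \sum_(k < #|u|) p`_k * (t y ^+ k * f y))).
    by rewrite exchange_big big1 //= => k _; rewrite -mulr_sumr f0 ?mulr0.
  move=> y _; rewrite (horner_coef_wide _ p_size) mulr_suml.
  by apply: eq_bigr => k _; rewrite mulrA.
rewrite (bigD1 x) //= big1 ?addr0 => [|y /andP[yu yx]]; last first.
  rewrite (_ : p.[t y] = 0) ?mul0r //; apply/rootP.
  by rewrite root_prod_XsubC map_f // mem_enum !inE yx.
move/eqP; rewrite mulf_eq0 => /orP[|/eqP //].
rewrite -[_ == 0]/(root p (t x)) root_prod_XsubC.
by case/mapP=> y; rewrite mem_enum !inE => /andP[yx _] /t_inj e;
  rewrite e eqxx in yx.
Qed.

Section Independence.
Variables (F : fieldType) (n d m l s : nat) (t : 'I_n -> F).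
Variables (G : digraph {set 'I_n}) (o : {set 'I_n}).
Hypotheses (char2 : 2 \in [pchar F]) (t_inj : injective t).
Hypothesis hG : pedigree d m l s G o.
Implicit Types (u w : {set 'I_n}) (i j : 'I_d) (y : 'I_n).
Local Notation C := ('I_d + 'I_n)%type.
Implicit Type T : {set C}.
Local Notation V := (vertices G).
Let Y := labels G :\: o.
Local Notation vol := (@vol F n d t Y).
Local Notation axis := (@axis F n d t Y).
Local Notation one := (@one F n).
Local Notation internal := (internal d G).
Local Notation cell := (cell G).

(** The coordinates and the constant 1 span all functions on the labels of the
    pedigree.  By linearity of determinants in each column, a relation between
    the volume vectors of the cells holds for determinants with arbitrary
    columns [gs] next to the column of ones. *)
Lemma cell_relation_extends (c : {set 'I_n} -> F) :
  \sum_(u in internal) c u *: vol (cell u) = 0 ->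
  forall gs cs,
    \sum_(u in internal) c u * permanent (cell u) (one :: gs ++ map axis cs) =
      0.
Proof.
move=> c0; elim=> [|g gs IH] cs.
  have [uq|nuq] := boolP (uniq cs); last first.
    rewrite big1 // => u _; rewrite permanent_not_uniq ?mulr0 // cat0s
      cons_uniq negb_and.
    by rewrite (contra (@map_uniq _ _ _ _) nuq) orbT.
  transitivity ((\sum_(u in internal) c u *: vol (cell u)) [set x in cs]).
    rewrite sum_ffunE; apply: eq_bigr => u _; rewrite [RHS]ffunE; congr (_ * _).
    rewrite ffunE; apply: permanent_perm; rewrite perm_cons; apply: perm_map.
    by apply: uniq_perm; rewrite ?enum_uniq // => x; rewrite mem_enum inE.
  by rewrite c0 ffunE.
pose rest := one :: gs ++ map axis cs.
(* The relation with first column h is linear in h, with coefficients f; the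
   aim is f = 0. *)
pose f x :=
  \sum_(u in internal | x \in cell u) c u * permanent (cell u :\ x) rest.
have fE h :
    \sum_(u in internal) c u * permanent (cell u) (h :: rest) =
      \sum_x h x * f x.
  transitivity (\sum_(u in internal) \sum_(x in cell u)
      h x * (c u * permanent (cell u :\ x) rest)).
    apply: eq_bigr => u _; rewrite /permanent -/permanent mulr_sumr.
    by apply: eq_bigr => x _; rewrite mulrCA.
  rewrite (exchange_big_dep predT) //=.
  by apply: eq_bigr => x _; rewrite mulr_sumr.
have f_one : \sum_x one x * f x = 0.
  by rewrite -fE big1 // => u _; rewrite permanent_dup ?mulr0.
have f_axis a : \sum_x axis a x * f x = 0.
  rewrite -fE -[RHS](IH (a :: cs)); apply: eq_bigr => u _; congr (_ * _).
  rewrite permanent_swap; apply: permanent_perm; rewrite perm_cons /=.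
  by rewrite -perm_rcons -cats1 -catA perm_cat2l /= cats1 perm_rcons.
(* Private coordinates settle the labels in Y; labels outside the pedigree are
   in no cell. *)
have f_Y x : x \notin o -> f x = 0.
  move=> xo; have [xU|xU] := boolP (x \in labels G).
    rewrite -[RHS](f_axis (inr x)) (bigD1 x) //= ffunE !inE xo xU eqxx mul1r.
    rewrite big1 ?addr0 // => y /negbTE yx;
      rewrite ffunE [x == y]eq_sym yx andbF mul0r //.
  rewrite /f big1 // => u /andP[uI xu]; case/negP: xU.
  exact: subsetP (cell_sub_labels hG uI) _ xu.
have sum_o h : \sum_x h x * f x = \sum_(x in o) h x * f x.
  rewrite (bigID (mem o)) /= [X in _ + X]big1 ?addr0 // => x xo.
  by rewrite f_Y ?mulr0.
have f_o x : x \in o -> f x = 0.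
  apply: (moments_eq0 t_inj) => k; rewrite (ped_card hG (ped_root_in hG)).
  case: k => [_|k kd].
    by rewrite -[RHS]f_one sum_o; apply: eq_bigr => y _; rewrite ffunE expr0.
  rewrite -[RHS](f_axis (inl (Ordinal (kd : (k < d)%N)))) sum_o.
  by apply: eq_bigr => y _; rewrite ffunE.
transitivity (\sum_(u in internal) c u * permanent (cell u) (g :: rest)).
  by apply: eq_bigr => u _; rewrite -/rest permanent_swap.
rewrite fE big1 // => x _; have [xo|xo] := boolP (x \in o).
  by rewrite f_o ?mulr0.
by rewrite f_Y ?mulr0.
Qed.

(** Among the vertices with a nonzero coefficient pick v without a parent among
    them, and use the indicator functions of the elements of v as columns.
    The determinant of a cell is then 1 if the cell contains v and 0 otherwise;
    it contains v only for v itself and its parents. *)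
Lemma cell_independent (c : {set 'I_n} -> F) :
  \sum_(u in internal) c u *: vol (cell u) = 0 ->
  forall u, u \in internal -> c u = 0.
Proof.
move=> c0 u uI; apply/eqP; apply: contraT => cu.
pose X := [set u in internal | c u != 0].
have /(acyclic_source (ped_acyclic hG))[v] : X != set0.
  by apply/set0Pn; exists u; rewrite inE uI.
rewrite in_set => /andP[vI cv] src.
have vV : v \in V by case/setIdP: vI.
have := cell_relation_extends c0 [seq dirac F x | x <- enum v] [::].
rewrite cats0 (bigD1 v) //= big1 ?addr0 => [|w /andP[wI wv]].
  have [z [zv -> _]] := cellP hG vI.
  rewrite -{1}[v in _ |: v]set_enum permanent_diracs ?mulr1 => [/eqP|].
    by rewrite (negbTE cv).
  by rewrite /= enum_uniq mem_enum zv.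
have [->|cw] := eqVneq (c w) 0; first by rewrite mul0r.
have : ~~ (v \subset cell w).
  apply/negP => /(sub_cell hG wI vV)[e|wv']; first by rewrite e eqxx in wv.
  by move: (src _ wv'); rewrite in_set wI cw.
case/subsetPn=> x xv xw.
rewrite (@permanent_vanish _ _ _ (dirac F x)) ?mulr0 //.
  by rewrite inE map_f ?orbT // mem_enum.
move=> y yw; rewrite ffunE; case: eqVneq => // e.
by rewrite e yw in xw.
Qed.

Lemma dim_cell_span : \dim (cell_span d t G o) = m.
Proof.
rewrite -(ped_internal hG); apply: dim_span_image_free => c c0.
exact: cell_independent.
Qed.
End Independence.

(** * Counting leading sets *)

Section Count.
Variables (n d m l s : nat) (G : digraph {set 'I_n}) (o : {set 'I_n}).
Hypotheses (hd : (2 <= d)%N) (hG : pedigree d m l s G o).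
Local Notation C := ('I_d + 'I_n)%type.
Implicit Type T : {set C}.
Local Notation axes := (@axes n d).

Lemma char2_field_with_points :
  exists (F : fieldType) (t : 'I_n -> F), 2 \in [pchar F] /\ injective t.
Proof.
have [F c2 cF] := @pPrimePowerField 2 n.+1 isT isT.
have lt (i : 'I_n) : (i < #|F|)%N.
  by rewrite cF (ltn_trans (ltn_ord i)) // (ltn_trans (ltnSn n)) // ltn_expl.
exists F, (fun i => enum_val (Ordinal (lt i))); split=> // i j /enum_val_inj e.
by apply: val_inj; case: e.
Qed.

(** Here x counts the leading d-sets of the leaves with at most d - 2 axes, and
    q the leading (d + 1)-sets of the cells with at most d - 2 axes. *)
Lemma leaf_and_internal_counts : exists x q : nat,
  [/\ (x + (d * s).+1 <= l)%N, (m <= s + d * x + q)%N & (q ^ d <= x ^ d.+1)%N].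
Proof.
have [F [t [c2 t_inj]]] := char2_field_with_points.
pose S := lead (weight axes) (cell_span d t G o).
pose L := lead (weight axes) (leaf_span d t G o).
have cardS : #|S| = m.
  by rewrite (card_lead (@weight_inj _ _)) (dim_cell_span c2 t_inj hG).
have cardL : (#|L| <= l)%N.
  by rewrite (card_lead (@weight_inj _ _)) (dim_leaf_span _ hG).
have Sk T : T \in S -> #|T| = d.+1.
  by case/leadP=> v vA [vT _]; have [] := cell_span_support hG vA vT.
have SY T y : T \in S -> inr y \in T -> y \in labels G :\: o.
  by case/leadP=> v vA [vT _]; have [_] := cell_span_support hG vA vT; apply.
have Lk T : T \in L -> #|T| = d.
  by case/leadP=> v vA [vT _]; have [] := leaf_span_support hG vA vT.
pose L' := [set T in L | (#|T :&: axes| < d.-1)%N].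
have sh T c : T \in S -> c \in T -> T :\ c \in L by apply: (lead_shadow c2 hG).
exists #|L'|, #|[set T in S | (#|T :&: axes| < d.-1)%N]|.
set S2 := [set T in S | _].
pose S0 := [set T in S | axes \subset T].
pose S1 := [set T in S | #|T :&: axes| == d.-1].
have axD1 T j : inl j \in T -> #|T :&: axes| = #|(T :\ inl j) :&: axes|.+1.
  by move=> jT; rewrite (cardsD1 (inl j)) inE jT inl_axes setIDAC.
split.
- have disj : [disjoint L' & near_axes d G o].
    rewrite disjoint_sym; apply/pred0P => T /=; apply/negP => /andP[Tt].
    rewrite inE ltnNge => /andP[_ /negP]; apply.
    move: Tt => /setU1P[->|/imsetP[[j y] _ ->]];
      first by rewrite setIid card_axes leq_pred.
    rewrite -[X in (X.-1 <= _)%N](card_axes n d) (cardsD1 (inl j)) inl_axes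
      add1n /=.
    by rewrite subset_leq_card // subsetI subsetDl subsetU1.
  have /eqP <- : #|L' :|: near_axes d G o| == (#|L'| + (d * s).+1)%N.
    by rewrite -(card_near_axes hG) (leq_card_setU _ _).2.
  apply: leq_trans cardL; apply: subset_leq_card; rewrite subUset.
  by rewrite (near_axes_sub_lead c2 t_inj hG) andbT;
    apply/subsetP=> T /setIdP[].
- rewrite -cardS.
  (* A set with all axes is determined by its only label. *)
  have card0 : (#|S0| <= s)%N.
    rewrite -(card_new_labels hG).
    rewrite -(card_imset _ (_ : injective (fun y => inr y |: axes)));
      last first.
      move=> y y' /setP/(_ (inr y)); rewrite setU11 => /esym.
      by rewrite inE inr_axes orbF => /set1P[].
    apply/subset_leq_card/subsetP => T /setIdP[TS axT].
    have : #|T :\: axes| = 1 by rewrite cardsDS // Sk // card_axes subSn ?subnn.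
    move/eqP/cards1P => [c ec].
    have /setDP[cT cA] : c \in T :\: axes by rewrite ec set11.
    have {}eT : T = c |: axes by rewrite -ec -{1}(setID T axes) (setIidPr axT)
      setUC.
    case: c => [j|y] in cT cA ec eT; first by rewrite inl_axes in cA.
    by rewrite eT; apply: imset_f; apply: SY cT.
  (* Such a set contains an axis because d >= 2, and is recovered from that axis
     and the rest. *)
  have card1 : (#|S1| <= d * #|L'|)%N.
    have : S1 \subset [set inl p.1 |: p.2 | p in setX [set: 'I_d] L'].
      apply/subsetP=> T /setIdP[TS /eqP Tax].
      have /card_gt0P[c] : (0 < #|T :&: axes|)%N by rewrite Tax -subn1 subn_gt0.
      rewrite inE => /andP[cT /imsetP[j _ ec]]; rewrite {}ec in cT.
      apply/imsetP; exists (j, T :\ inl j); last by rewrite /= setD1K.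
      rewrite in_setX in_setT /= inE sh //=.
      by move: Tax; rewrite (axD1 _ _ cT) => <-.
    move/subset_leq_card => /leq_trans; apply.
    by apply: leq_trans (leq_imset_card _ _) _; rewrite cardsX cardsT card_ord.
  have : S \subset S0 :|: S1 :|: S2.
    apply/subsetP=> T TS; case: (ltngtP #|T :&: axes| d.-1) => [lt|gt|e].
    - by apply/setUP; right; apply/setIdP.
    - apply/setUP; left; apply/setUP; left; apply/setIdP; split=> //.
      suff <- : T :&: axes = axes by apply: subsetIl.
      apply/eqP; rewrite eqEcard subsetIr card_axes.
      exact: leq_trans (leqSpred d) gt.
    by apply/setUP; left; apply/setUP; right; apply/setIdP; rewrite e.
  move/subset_leq_card => /leq_trans; apply.
  apply: leq_trans (leq_card_setU _ _) _; rewrite leq_add2r.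
  by apply: leq_trans (leq_card_setU _ _) _; apply: leq_add.
- have [->|S20] := eqVneq S2 set0; first by rewrite cards0 exp0n // ltnW.
  apply: (shadow_bound S20) => [T|T|T c].
  + by case/setIdP=> /Sk.
  + by case/setIdP=> /Lk.
  case/setIdP=> TS lt cT; rewrite inE sh //=; apply: leq_ltn_trans lt.
  by apply/subset_leq_card/setSI/subsetDl.
Qed.
End Count.

Theorem theorem3p5 (R : realType) (n d m l s : nat)
    (G : digraph {set 'I_n}) (o : {set 'I_n})
    (hn : (0 < n)%N) (hd : (2 <= d)%N) (hG : pedigree d m l s G o) :
  let a := leaf_excess d l s in
  let b := tree_excess G in
  [/\ b = d%:Z * m%:Z - (l%:Z - 1),
      0 <= a
    & (b%:~R : R) <= d%:R * (a%:~R : R) `^ (d.+1%:R / d%:R)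
                     + (d%:R ^+ 2 - 1) * (a%:~R : R)].
Proof.
move=> a b.
have eb : b = d%:Z * m%:Z - (l%:Z - 1).
  rewrite /b /tree_excess (card_edges hG) (ped_order hG) PoszM PoszD.
  by rewrite -addn1 PoszD; lia.
have [x [q [xl mq qx]]] := leaf_and_internal_counts hd hG.
have d_gt0 : (0 < d)%N by exact: ltnW.
have [k lk] : exists k, l = (k + (d * s).+1)%N by exists (l - (d * s).+1)%N;
  lia.
have ea : a = k%:Z by rewrite /a /leaf_excess lk; lia.
split=> //; first by rewrite ea.
have xk : (x <= k)%N by lia.
have ebk : (b%:~R : R) = d%:R * (m%:R - s%:R) - k%:R.
  have -> : b = d%:Z * (m%:Z - s%:Z) - k%:Z by rewrite eb lk; lia.
  by rewrite rmorphB rmorphM rmorphB.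
have mqR : (m%:R : R) <= s%:R + d%:R * k%:R + q%:R.
  by rewrite -natrM -!natrD ler_nat (leq_trans mq) // leq_add2r leq_add2l
    leq_mul2l xk orbT.
have dn0 : d%:R != 0 :> R by rewrite pnatr_eq0 -lt0n.
have qk : (q%:R : R) <= k%:R `^ (d.+1%:R / d%:R).
  rewrite -(ler_pXn2r d_gt0) ?nnegrE ?powR_ge0 //.
  rewrite -[leRHS]powR_mulrn ?powR_ge0 // -powRrM divfK // powR_mulrn //.
  by rewrite -!natrX ler_nat (leq_trans qx) // leq_exp2r.
rewrite ebk ea -[k%:~R]/(k%:R).
have : d%:R * (m%:R - s%:R)
    <= d%:R * (d%:R * k%:R + k%:R `^ (d.+1%:R / d%:R)) :> R.
  by apply: ler_wpM2l => //; lra.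
move=> h; lra.
Qed.
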